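(* Let $L/K$ be a degree $2$ Galois extension of fields with Galois group generated by $\sigma$, let $n\ge 1$, and assume that $\langle\ ,\ \rangle$ is definite up to $n$. Let $M\in M_{n,n}(L)$. Fix eigenvalues $a,b\in L$ of $M$ with $a\ne b$ and assume that there exist $u,v\in L^n$ such that $\langle u,u\rangle\in\Delta\setminus\{0\}$, $\langle v,v\rangle\in\Delta\setminus\{0\}$, $Mu=au$ and $Mv=bv$. (a) If $\langle u,v\rangle=0$, then $\mathrm{Num}(M)\supseteq\{ta+(1-t)b \mid t\in\Delta\cap(1-\Delta)\}$. (b) If $\langle u,v\rangle\ne 0$, then there is a subset $S\subseteq\mathrm{Num}(M)$ such that $a\in S$, $b\in S$ and $S$ is a $\Delta_n$-ellipse.
   Context: $M_{n,n}(F)$ is the set of $n\times n$ matrices over a field $F$. For $u,v\in L^n$ set $\langle u,v\rangle:=\sum_{i=1}^n\sigma(u_i)v_i$. The form $\langle\ ,\ \rangle$ is definite up to $n$ if $\langle u,u\rangle\ne 0$ for all $u\in L^n\setminus\{0\}$. The numerical range of $M\in M_{n,n}(L)$ is $\mathrm{Num}(M):=\{\langle u,Mu\rangle \mid u\in L^n,\ \langle u,u\rangle=1\}\subseteq L$. $\Delta:=\{a\sigma(a)\mid a\in L\}\subseteq K$ (the image of the norm map $L\to K$), $1-\Delta:=\{1-s\mid s\in\Delta\}$, and $\Delta_n\subseteq K$ is the set of sums of $n$ elements of $\Delta$, i.e. $\Delta_n=\{\langle u,u\rangle\mid u\in L^n\}$. A $\Delta_n$-ellipse with a unique focus at $0$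 is a subset of $L$ of the form $\{\sigma(x)y\mid (x,y)\in L^2,\ \delta_1x\sigma(x)+\delta_2y\sigma(y)=1\}$ for some $\delta_1,\delta_2\in\Delta_n\setminus\{0\}$. A $\Delta_n$-ellipse with two foci is a subset of $L$ of the form $\{d_1y\sigma(x)+d_2y\sigma(y)\mid (x,y)\in L^2,\ \delta_1x\sigma(x)+\delta_2y\sigma(y)=1\}$ for some $\delta_1,\delta_2\in\Delta_n\setminus\{0\}$ and $d_1,d_2\in L\setminus\{0\}$. A $\Delta_n$-ellipse is a set $S\subseteq L$ such that there are $e,f\in L$ with $f\ne 0$ for which $(S-e)/f$ is a $\Delta_n$-ellipse with a unique focus at $0$ or a $\Delta_n$-ellipse with two foci. *)

(* Defs.v *)
From mathcomp Require Import all_boot all_order all_fingroup all_algebra all_field.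
From mathcomp Require Import classical_sets.

Set Implicit Arguments.
Unset Strict Implicit.
Unset Printing Implicit Defensive.

Import GRing.Theory.

Local Open Scope classical_set_scope.
Local Open Scope ring_scope.

(* [sigma] is kept as a bare function here; it is meant to be the nontrivial
   automorphism of a degree 2 Galois extension L/K.  The subsets of K below
   (norms and sums of norms) are represented by their images in L. *)
Section NumericalRange.
Variables (L : fieldType) (sigma : L -> L).

Definition sdot n (u v : 'cV[L]_n) : L := \sum_i sigma (u i 0) * v i 0.

Definition definite_upto (n : nat) : Prop :=
  forall u : 'cV[L]_n, u != 0 -> sdot u u != 0.

Definition num_range n (M : 'M[L]_n) : set L :=
  [set sdot u (M *m u) | u in [set u : 'cV[L]_n | sdot u u = 1]].

Definition norms : set L := [set a * sigma a | a in [set: L]].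

Definition one_sub_norms : set L := [set 1 - s | s in norms].

Definition norm_sums (n : nat) : set L :=
  [set \sum_i s i | s in [set s : 'I_n -> L | forall i, norms (s i)]].

Definition ellipse_params (d1 d2 : L) : set (L * L) :=
  [set p | d1 * p.1 * sigma p.1 + d2 * p.2 * sigma p.2 = 1].

Definition unique_focus_ellipse (n : nat) (S : set L) : Prop :=
  exists delta1 delta2 : L,
    [/\ norm_sums n delta1, delta1 != 0, norm_sums n delta2, delta2 != 0 &
        S = [set sigma p.1 * p.2 | p in ellipse_params delta1 delta2]].

Definition two_foci_ellipse (n : nat) (S : set L) : Prop :=
  exists delta1 delta2 d1 d2 : L,
    [/\ norm_sums n delta1 /\ delta1 != 0, norm_sums n delta2 /\ delta2 != 0,
        d1 != 0, d2 != 0 &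
        S = [set d1 * p.2 * sigma p.1 + d2 * p.2 * sigma p.2
               | p in ellipse_params delta1 delta2]].

Definition norm_ellipse (n : nat) (S : set L) : Prop :=
  exists e f : L,
    f != 0 /\
    (unique_focus_ellipse n [set (s - e) / f | s in S] \/
     two_foci_ellipse n [set (s - e) / f | s in S]).

End NumericalRange.

(* Main.v *)
Require Import Defs.
From mathcomp Require Import all_boot all_order all_fingroup all_algebra all_field.
From mathcomp Require Import classical_sets ring.

Set Implicit Arguments.
Unset Strict Implicit.
Unset Printing Implicit Defensive.

Import GRing.Theory.

Local Open Scope classical_set_scope.
Local Open Scope ring_scope.

(** If [<u,u>] is a nonzero norm, then [u] rescales to a unit eigenvector, and likewise [v]; unit
    vectors in the plane of [u] and [v] then supply the required values. When [u] and [v] are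
    orthogonal, [x u + y v] has square [x sigma(x) + y sigma(y)] and value
    [a x sigma(x) + b y sigma(y)], which gives (a) in [num_range_orthogonal]. Otherwise Gram-Schmidt
    makes the plane orthogonal, and the values fill an affine image of a two-foci ellipse
    ([num_range_ellipse]). *)

Section InvolutiveForm.
Variables (L : fieldType) (sigma : {rmorphism L -> L}).
Hypothesis sigmaK : involutive sigma.

Lemma sdotDl n (x y z : 'cV[L]_n) :
  sdot sigma (x + y) z = sdot sigma x z + sdot sigma y z.
Proof.
by rewrite -big_split; apply: eq_bigr => i _; rewrite mxE rmorphD mulrDl.
Qed.

Lemma sdotDr n (x y z : 'cV[L]_n) :
  sdot sigma x (y + z) = sdot sigma x y + sdot sigma x z.
Proof.
by rewrite -big_split; apply: eq_bigr => i _; rewrite mxE mulrDr.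
Qed.

Lemma sdotZl n k (x y : 'cV[L]_n) :
  sdot sigma (k *: x) y = sigma k * sdot sigma x y.
Proof.
by rewrite mulr_sumr; apply: eq_bigr => i _; rewrite mxE rmorphM mulrA.
Qed.

Lemma sdotZr n k (x y : 'cV[L]_n) :
  sdot sigma x (k *: y) = k * sdot sigma x y.
Proof. by rewrite mulr_sumr; apply: eq_bigr => i _; rewrite mxE mulrCA. Qed.

Lemma sdotC n (x y : 'cV[L]_n) : sdot sigma y x = sigma (sdot sigma x y).
Proof.
by rewrite rmorph_sum; apply: eq_bigr => i _; rewrite rmorphM sigmaK mulrC.
Qed.

Lemma norm_sums_sdot n (x : 'cV[L]_n) : norm_sums sigma n (sdot sigma x x).
Proof.
exists (fun i => x i 0 * sigma (x i 0)) => [i|]; first by exists (x i 0).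
by apply: eq_bigr => i _; rewrite mulrC.
Qed.

(** If [<u,u> = c sigma(c)], the factor [c^-1] works. *)
Lemma normalize_eigenvector n (M : 'M[L]_n) a (u : 'cV[L]_n) :
    norms sigma (sdot sigma u u) -> sdot sigma u u <> 0 -> M *m u = a *: u ->
  exists2 k, k != 0 & sdot sigma (k *: u) (k *: u) = 1
                      /\ M *m (k *: u) = a *: (k *: u).
Proof.
move=> [c _ uuE] /eqP; rewrite -uuE mulf_eq0 negb_or => /andP[c0 sc0] Mu.
exists c^-1; first by rewrite invr_eq0.
split; last by rewrite -scalemxAr Mu !scalerA mulrC.
rewrite sdotZl sdotZr -uuE fmorphV; field.
by rewrite c0 sc0.
Qed.

Lemma num_range_orthogonal n (M : 'M[L]_n) a b (u v : 'cV[L]_n) :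
    sdot sigma u u = 1 -> sdot sigma v v = 1 -> sdot sigma u v = 0 ->
    M *m u = a *: u -> M *m v = b *: v ->
  [set t * a + (1 - t) * b | t in norms sigma `&` one_sub_norms sigma]
    `<=` num_range sigma M.
Proof.
move=> uu vv uv Mu Mv _ [_ [[x _ <-] [_ [y _ <-] eqx]] <-].
have vu : sdot sigma v u = 0 by rewrite sdotC uv rmorph0.
(* Here [t = x sigma(x) = 1 - y sigma(y)], so [x] and [y] themselves serve as coefficients. *)
have <- : y * sigma y = 1 - x * sigma x by rewrite -eqx; ring.
exists (x *: u + y *: v) => /=.
  rewrite !(sdotDl, sdotDr, sdotZl, sdotZr) uu vv uv vu.
  by rewrite -[RHS](subrK (y * sigma y)) eqx; ring.
rewrite mulmxDr -!scalemxAr Mu Mv !(sdotDl, sdotDr, sdotZl, sdotZr) uu vv uv vu.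
ring.
Qed.

(* With c = <u,v>, the vector z = v - c u is orthogonal to u and
   M z = b z + (b - a) c u, so on the unit vectors w = x u + y z one finds
   <w, M w> = a + (b - a) (c y sigma(x) + <z,z> y sigma(y)). *)
Lemma num_range_ellipse n (M : 'M[L]_n) a b (u v : 'cV[L]_n) :
    definite_upto sigma n -> a != b ->
    sdot sigma u u = 1 -> sdot sigma v v = 1 -> sdot sigma u v != 0 ->
    M *m u = a *: u -> M *m v = b *: v ->
  exists S : set L,
    [/\ S `<=` num_range sigma M, S a, S b & norm_ellipse sigma n S].
Proof.
move=> definite ab uu vv uv Mu Mv.
set c := sdot sigma u v in uv.
have vu : sdot sigma v u = sigma c by rewrite sdotC.
have [z zE] : exists z, z = v + (- c) *: u by exists (v + (- c) *: u).
have uz : sdot sigma u z = 0 by rewrite zE sdotDr sdotZr uu -/c; ring.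
have zu : sdot sigma z u = 0 by rewrite sdotC uz rmorph0.
have zz : sdot sigma z z = 1 - c * sigma c.
  rewrite {2}zE sdotDr sdotZr zu zE sdotDl sdotZl vv -/c rmorphN; ring.
have Mz : M *m z = b *: z + ((b - a) * c) *: u.
  rewrite zE mulmxDr -scalemxAr Mu Mv scalerDr !scalerA -addrA -scalerDl.
  by congr (_ + _ *: _); ring.
(* If [z = 0], then [Mz] reads [(b - a) c u = 0], which contradicts [a != b], [c != 0] and
   [<u,u> = 1]. *)
have z0 : z != 0.
  apply/eqP => z0; move: Mz; rewrite z0 mulmx0 scaler0 add0r => /esym/eqP.
  rewrite scaler_eq0 mulf_eq0 subr_eq0 eq_sym (negPf ab) (negPf uv) /=.
  move=> /eqP u0; move/eqP: uu.
  by rewrite u0 -(scale0r 0) sdotZr mul0r eq_sym oner_eq0.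
have ba : b - a != 0 by rewrite subr_eq0 eq_sym.
have zz0 := definite z z0.
(* The parameter equation says exactly that [w = x u + y z] is a unit vector, since [u] and [z] are
   orthogonal. *)
pose E := [set c * p.2 * sigma p.1 + sdot sigma z z * p.2 * sigma p.2
             | p in ellipse_params sigma 1 (sdot sigma z z)].
exists [set a + (b - a) * t | t in E]; split.
- move=> _ [_ [[x y] /= xy1 <-] <-].
  rewrite /ellipse_params /= in xy1.
  exists (x *: u + y *: z) => /=.
    by rewrite !(sdotDl, sdotDr, sdotZl, sdotZr) uu uz zu -[RHS]xy1; ring.
  rewrite mulmxDr -!scalemxAr Mu Mz !(sdotDl, sdotDr, sdotZl, sdotZr) uu uz zu.
  (* The constant term [a] is written as [a <w,w>] to match the expansion. *)
  by rewrite -[X in _ = X + _]mulr1 -[X in _ = a * X + _]xy1; ring.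
(* The value [a] comes from [w = u]. *)
- exists 0; last by rewrite mulr0 addr0.
  exists (1, 0) => /=; last by rewrite !(mulr0, mul0r) addr0.
  by rewrite /ellipse_params /= rmorph1; ring.
(* The value [b] comes from [w = c u + z = v]; the point of [E] is [c sigma(c) + <z,z> = 1]. *)
- exists 1; last by ring.
  by exists (c, 1); rewrite /ellipse_params /= ?rmorph1 zz; ring.
exists a, (b - a); split=> //; right.
exists 1, (sdot sigma z z), c, (sdot sigma z z); split=> //.
- by split; [rewrite -uu; apply: norm_sums_sdot | apply: oner_neq0].
- by split; [apply: norm_sums_sdot |].
rewrite -/E; apply/seteqP; split=> [_ [_ [t Et <-] <-]|t Et].
  by rewrite addrC addKr mulrAC divff // mul1r.
exists (a + (b - a) * t); first by exists t.
by rewrite addrC addKr mulrAC divff // mul1r.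
Qed.

End InvolutiveForm.

(** The Galois group has order [[L:K] = 2], so its generator squares to the identity; this makes the
    form Hermitian. *)
Lemma quadratic_galois_involutive (K : fieldType) (L : splittingFieldType K)
    (sigma : gal_of {:L}) :
    \dim {:L} = 2%N -> galois 1%AS {:L} ->
    'Gal({:L} / 1%VS)%g = <[sigma]>%g -> involutive sigma.
Proof.
move=> dimL galL genL x.
have := galois_dim galL; rewrite genL dimv1 divn1 dimL => ord2.
rewrite -[RHS](gal_id {:L}) -(expg_order sigma) /order -ord2.
by rewrite expgS expg1 galM ?memvf.
Qed.

(* MathComp world.  [eigenvalue] speaks of row vectors, hence the transpose:
   [eigenvalue M^T a] says that some nonzero column w satisfies M w = a w. *)
Theorem theorem1 (K : fieldType) (L : splittingFieldType K)
    (sigma : gal_of {:L})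
    (degree_two : \dim {:L} = 2%N)
    (galois_LK : galois 1%AS {:L})
    (sigma_gen : 'Gal({:L} / 1%VS)%g = <[sigma]>%g)
    (n : nat) (n_ge1 : (1 <= n)%N)
    (definite : definite_upto sigma n)
    (M : 'M[L]_n) (a b : L)
    (eig_a : eigenvalue M^T a) (eig_b : eigenvalue M^T b) (neq_ab : a <> b)
    (u v : 'cV[L]_n)
    (uu_norm : norms sigma (sdot sigma u u)) (uu_neq0 : sdot sigma u u <> 0)
    (vv_norm : norms sigma (sdot sigma v v)) (vv_neq0 : sdot sigma v v <> 0)
    (Mu : M *m u = a *: u) (Mv : M *m v = b *: v) :
  (sdot sigma u v = 0 ->
     [set t * a + (1 - t) * b | t in norms sigma `&` one_sub_norms sigma]
       `<=` num_range sigma M)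
  /\
  (sdot sigma u v <> 0 ->
     exists S : set L,
       [/\ S `<=` num_range sigma M, S a, S b & norm_ellipse sigma n S]).
Proof.
have sK := quadratic_galois_involutive degree_two galois_LK sigma_gen.
have [k k0 [uu Mku]] := normalize_eigenvector uu_norm uu_neq0 Mu.
have [l l0 [vv Mlv]] := normalize_eigenvector vv_norm vv_neq0 Mv.
have uvE : sdot sigma (k *: u) (l *: v) = sigma k * (l * sdot sigma u v).
  by rewrite sdotZl sdotZr.
split=> uv.
  by apply: (num_range_orthogonal sK uu vv _ Mku Mlv); rewrite uvE uv !mulr0.
apply: (num_range_ellipse sK definite _ uu vv _ Mku Mlv); first exact/eqP.
by rewrite uvE !mulf_neq0 ?fmorph_eq0 //; apply/eqP.
Qed.
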